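(* Let $(K,T,+,;,{}^*,\rightarrow,0,1)$ be an idempotent graded Kleene algebra with tests (I-GKAT) that additionally satisfies $(a+b)\rightarrow 0=(a\rightarrow 0);(b\rightarrow 0)$ for all $a,b\in T$. Then for all $b,c\in T$ and $p,q\in K$, $$(b;p;(c;q)^*;(c\rightarrow0))^*;(b\rightarrow0)\;=\;b;p;\big((b+c);(c;q+(c\rightarrow0);p)\big)^*;((b+c)\rightarrow0)+(b\rightarrow0).$$ That is, the program ''while $b$ do begin $p$; while $c$ do $q$ end'' is equivalent to ''if $b$ then begin $p$; while $b+c$ do (if $c$ then $q$ else $p$) end''.
   Context: A graded Kleene algebra with tests (GKAT) is a tuple $(K,T,+,;,{}^*,\rightarrow,0,1)$ where $K$ is a set, $T\subseteq K$, $0,1\in T$, $+$ and $;$ are binary operations on $K$ under which $T$ is closed, ${}^*$ is unary on $K$, and $\rightarrow$ is a binary operation on $T$ with values in $T$, such that for all $p,q,r\in K$ and $a,b,c\in T$: $p+(q+r)=(p+q)+r$; $p+q=q+p$; $p;(q;r)=(p;q);r$; $p;1=1;p=p$; $p;(q+r)=p;q+p;r$; $(p+q);r=p;r+q;r$; $p;0=0;p=0$; $1+p;p^*=p^*$; $q+p;r\leq r\Rightarrow p^*;q\leq r$; $q+r;p\leq r\Rightarrow q;p^*\leq r$; $a;b\leq c\Leftrightarrow b\leq a\rightarrow c$; $a\leq 1$; $a;b=b;a$, where $p\leq q$ means $p+q=q$. An I-GKAT is a GKAT additionally satisfying $a;a=a$ for all $a\in T$. Program encodings: ''if $b$ then $p$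 else $q$'' is $b;p+(b\rightarrow0);q$; ''if $b$ then $p$'' is $b;p+(b\rightarrow 0)$; ''while $b$ do $p$'' is $(b;p)^*;(b\rightarrow0)$. *)

(* Defs.v *)
(* No library beyond the Rocq prelude is used: MathComp's semirings carry a
   choiceType structure, which an arbitrary set K does not provide. *)

Set Implicit Arguments.
Unset Strict Implicit.
Unset Printing Implicit Defensive.

(* The tuple (K, T, +, ;, *, ->, 0, 1): T is a predicate on K, and the
   implication is an operation on the subset T with values in T. *)
Record gkat_sig : Type := GkatSig {
  carrier :> Type;
  is_test : carrier -> Prop;
  add : carrier -> carrier -> carrier;
  seq : carrier -> carrier -> carrier;
  star : carrier -> carrier;
  arrow : {a | is_test a} -> {a | is_test a} -> {a | is_test a};
  zero : carrier;
  one : carrier;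
  zero_test : is_test zero;
  one_test : is_test one;
  add_test : forall a b, is_test a -> is_test b -> is_test (add a b);
  seq_test : forall a b, is_test a -> is_test b -> is_test (seq a b)
}.

Arguments zero {_}.
Arguments one {_}.

Definition test (K : gkat_sig) : Type := {a : K | is_test a}.

Definition test_val (K : gkat_sig) (a : test K) : carrier K := proj1_sig a.
Coercion test_val : test >-> carrier.

Definition imp (K : gkat_sig) (a b : test K) : test K := arrow a b.

Definition test_zero {K : gkat_sig} : test K := exist _ zero (zero_test K).

Definition test_add (K : gkat_sig) (a b : test K) : test K :=
  exist _ (add (proj1_sig a) (proj1_sig b))
    (add_test (proj2_sig a) (proj2_sig b)).

Definition le (K : gkat_sig) (p q : K) : Prop := add p q = q.

Declare Scope gkat_scope.
Delimit Scope gkat_scope with gkat.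
Bind Scope gkat_scope with carrier.
Declare Scope gkat_test_scope.
Delimit Scope gkat_test_scope with gtest.
Bind Scope gkat_test_scope with test.

Reserved Notation "p ;; q" (at level 40, left associativity).
Reserved Notation "p ^*" (at level 1, left associativity, format "p ^*").
Reserved Notation "a --> b" (at level 55, no associativity).

Notation "p + q" := (add p q) : gkat_scope.
Notation "p ;; q" := (seq p q) : gkat_scope.
Notation "p ^*" := (star p) : gkat_scope.
Notation "p <= q" := (le p q) : gkat_scope.
Notation "0" := zero : gkat_scope.
Notation "1" := one : gkat_scope.

(* The operands of an implication are read as elements of T, so that inside
   them + and 0 denote the restrictions of the operations of K to T. *)
Notation "a --> b" := (imp a%gtest b%gtest) : gkat_scope.
Notation "a --> b" := (imp a b) : gkat_test_scope.
Notation "a + b" := (test_add a b) : gkat_test_scope.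
Notation "0" := test_zero : gkat_test_scope.

Local Open Scope gkat_scope.

Record gkat : Type := Gkat {
  gkat_base :> gkat_sig;
  addA : forall p q r : gkat_base, p + (q + r) = (p + q) + r;
  addC : forall p q : gkat_base, p + q = q + p;
  seqA : forall p q r : gkat_base, p ;; (q ;; r) = (p ;; q) ;; r;
  seq_one : forall p : gkat_base, p ;; 1 = p;
  one_seq : forall p : gkat_base, 1 ;; p = p;
  seq_addr : forall p q r : gkat_base, p ;; (q + r) = p ;; q + p ;; r;
  seq_addl : forall p q r : gkat_base, (p + q) ;; r = p ;; r + q ;; r;
  seq_zero : forall p : gkat_base, p ;; 0 = 0;
  zero_seq : forall p : gkat_base, 0 ;; p = 0;
  star_unfold : forall p : gkat_base, 1 + p ;; p^* = p^*;
  star_indl : forall p q r : gkat_base, q + p ;; r <= r -> p^* ;; q <= r;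
  star_indr : forall p q r : gkat_base, q + r ;; p <= r -> q ;; p^* <= r;
  imp_residual : forall a b c : test gkat_base, a ;; b <= c <-> b <= (a --> c);
  test_le_one : forall a : test gkat_base, a <= 1;
  test_seqC : forall a b : test gkat_base, a ;; b = b ;; a
}.

Record igkat : Type := Igkat {
  igkat_base :> gkat;
  test_seq_idem : forall a : test igkat_base, a ;; a = a
}.

Definition if_then_else (K : gkat_sig) (b : test K) (p q : K) : K :=
  b ;; p + (b --> 0) ;; q.

Definition if_then (K : gkat_sig) (b : test K) (p : K) : K :=
  b ;; p + (b --> 0).

Definition while (K : gkat_sig) (b : test K) (p : K) : K :=
  (b ;; p)^* ;; (b --> 0).

(* Main.v *)
(* Since [c ;; (c --> 0) = 0] and tests are idempotent, the body of the second
   loop is [c ;; q + (c --> 0) ;; b ;; p].  Denesting its star and sliding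
   [c --> 0] through the outer star turn it into one unfolding of the nested
   loop. *)
Require Import Defs.

Local Open Scope gkat_scope.

Section GKAT.

Context {K : gkat}.
Implicit Types p q r x y : K.

(** Idempotence comes from the test bound [1 <= 1], that is [1 + 1 = 1], multiplied on the left by
    [p]. *)
Lemma add_idem p : p + p = p.
Proof.
  pose proof (f_equal (seq p) (test_le_one (exist _ 1 (one_test K)))) as H.
  cbn in H. rewrite seq_addr, seq_one in H. exact H.
Qed.

(** The same device, now with the test bound [0 <= 1]. *)
Lemma zero_add p : 0 + p = p.
Proof.
  pose proof (f_equal (seq p) (test_le_one (@test_zero K))) as H.
  cbn in H. rewrite seq_addr, seq_zero, seq_one in H. exact H.
Qed.

Lemma add_zero p : p + 0 = p.
Proof. rewrite addC. apply zero_add. Qed.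

Lemma le_refl p : p <= p.
Proof. apply add_idem. Qed.

Lemma le_trans p q r : p <= q -> q <= r -> p <= r.
Proof.
  unfold le. intros pq qr. rewrite <- qr, addA, pq. reflexivity.
Qed.

Lemma le_antisym p q : p <= q -> q <= p -> p = q.
Proof.
  unfold le. intros pq qp. rewrite <- qp, addC. exact pq.
Qed.

Lemma le_addl p q : p <= p + q.
Proof. unfold le. rewrite addA, add_idem. reflexivity. Qed.

Lemma le_addr p q : q <= p + q.
Proof. rewrite addC. apply le_addl. Qed.

Lemma add_le p q r : p <= r -> q <= r -> p + q <= r.
Proof.
  unfold le. intros pr qr. rewrite <- addA, qr. exact pr.
Qed.

Lemma seq_le_l p q r : p <= q -> p ;; r <= q ;; r.
Proof.
  unfold le. intros pq. rewrite <- seq_addl, pq. reflexivity.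
Qed.

Lemma seq_le_r p q r : p <= q -> r ;; p <= r ;; q.
Proof.
  unfold le. intros pq. rewrite <- seq_addr, pq. reflexivity.
Qed.

Lemma one_le_star p : 1 <= p^*.
Proof. rewrite <- star_unfold. apply le_addl. Qed.

Lemma seq_star_le p : p ;; p^* <= p^*.
Proof. pattern (p^*) at 2. rewrite <- star_unfold. apply le_addr. Qed.

Lemma star_slide_le x y : (x ;; y)^* ;; x <= x ;; (y ;; x)^*.
Proof.
  apply star_indl.
  pattern ((y ;; x)^*) at 2. rewrite <- star_unfold.
  rewrite seq_addr, seq_one, !seqA. apply le_refl.
Qed.

Lemma star_seq_le p : p^* ;; p <= p^*.
Proof.
  apply le_trans with (p ;; p^*); [|apply seq_star_le].
  (* Sliding with second factor [1] yields [p^* ;; p <= p ;; p^*]. *)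
  pose proof (star_slide_le p 1) as H.
  rewrite seq_one, one_seq in H. exact H.
Qed.

Lemma star_slide x y : (x ;; y)^* ;; x = x ;; (y ;; x)^*.
Proof.
  apply le_antisym; [apply star_slide_le|].
  apply star_indr, add_le.
  - pattern x at 1. rewrite <- (one_seq x). apply seq_le_l, one_le_star.
  (* Regrouping exposes [(x ;; y)^* ;; (x ;; y)], which the star absorbs. *)
  - rewrite seqA, <- (seqA _ x y). apply seq_le_l, star_seq_le.
Qed.

(** Each side is bounded by star induction: the right side absorbs a left factor [x] or [y], and
    [(x + y)^*] absorbs a right factor [y ;; x^*]. *)
Lemma star_denest x y : (x + y)^* = x^* ;; (y ;; x^*)^*.
Proof.
  apply le_antisym.
  - rewrite <- (seq_one (x + y)^*). apply star_indl, add_le.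
    + apply le_trans with (x^*); [apply one_le_star|].
      pattern (x^*) at 1. rewrite <- (seq_one x^*). apply seq_le_r, one_le_star.
    + rewrite seq_addl. apply add_le.
      * rewrite seqA. apply seq_le_l, seq_star_le.
      * rewrite seqA. apply le_trans with ((y ;; x^*)^*).
        { apply seq_star_le. }
        pattern ((y ;; x^*)^*) at 1. rewrite <- one_seq. apply seq_le_l, one_le_star.
  - apply star_indr, add_le.
    + rewrite <- (seq_one x^*). apply star_indl, add_le.
      { apply one_le_star. }
      apply le_trans with ((x + y) ;; (x + y)^*); [|apply seq_star_le].
      apply seq_le_l, le_addl.
    + rewrite seqA. apply le_trans with ((x + y)^* ;; x^*).
      * apply seq_le_l.
        apply le_trans with ((x + y)^* ;; (x + y)); [|apply star_seq_le].
        apply seq_le_r, le_addr.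
      * apply star_indr, add_le; [apply le_refl|].
        apply le_trans with ((x + y)^* ;; (x + y)); [|apply star_seq_le].
        apply seq_le_r, le_addl.
Qed.

Lemma test_seq_neg (a : test K) : a ;; (a --> 0) = 0.
Proof.
  rewrite <- (add_zero (a ;; _)).
  (* With the added [0] the goal is literally [a ;; (a --> 0) <= 0], whose residual form is
     reflexivity. *)
  apply (imp_residual a (imp a test_zero) test_zero), le_refl.
Qed.

Lemma test_seq_le (a : test K) p : a ;; p <= p.
Proof. pattern p at 2. rewrite <- (one_seq p). apply seq_le_l, test_le_one. Qed.

End GKAT.

Lemma merged_body (K : igkat) (b c : test K) (p q : K) :
  (b + c) ;; (c ;; q + (c --> 0) ;; p) = c ;; q + (c --> 0) ;; b ;; p.
Proof.
  rewrite seq_addl, !seq_addr, !seqA, test_seq_idem, test_seq_neg, zero_seq,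
    add_zero, (test_seqC b (imp c test_zero)).
  (* The leftover [b ;; c ;; q] is brought next to [c ;; q], which absorbs it because [b <= 1]. *)
  rewrite (addC (b ;; c ;; q)), <- addA, addC, <- seqA.
  rewrite (test_seq_le b (c ;; q)). reflexivity.
Qed.

Theorem theorem7 (K : igkat)
    (deMorgan : forall a b : test K,
       ((a + b) --> 0) = (a --> 0) ;; (b --> 0) :> K)
    (b c : test K) (p q : K) :
  (b ;; p ;; (c ;; q)^* ;; (c --> 0))^* ;; (b --> 0)
    = b ;; p ;; ((b + c) ;; (c ;; q + (c --> 0) ;; p))^* ;; ((b + c) --> 0)
      + (b --> 0)
  /\
  while b (p ;; while c q)
    = if_then b (p ;; while (b + c) (if_then_else c q p)).
Proof.
  assert (E : (b ;; p ;; (c ;; q)^* ;; (c --> 0))^* ;; (b --> 0)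
    = b ;; p ;; ((b + c) ;; (c ;; q + (c --> 0) ;; p))^* ;; ((b + c) --> 0)
      + (b --> 0)).
  { rewrite merged_body, star_denest, deMorgan.
    (* The final [b --> 0] must come last on both sides, leaving [c --> 0] adjacent to the star it
       slides through. *)
    rewrite (test_seqC (imp b test_zero) (imp c test_zero)).
    (* Unfolding the outer loop once splits off [b --> 0], the case where the conditional is
       skipped. *)
    rewrite <- star_unfold, seq_addl, one_seq, addC. f_equal.
    rewrite !seqA. f_equal.
    rewrite <- (seqA _ (imp c test_zero)), <- star_slide, !seqA.
    reflexivity. }
  split; [exact E|].
  unfold if_then, while, if_then_else.
  (* The encoded programs differ from the equation only in bracketing. *)
  rewrite !seqA. exact E.
Qed.
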